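(* Let $k,\mu\in\mathbb{R}$ and let $(M,\phi,\xi,\eta,g)$ be a $(2n+1)$-dimensional $(k,\mu)'$-almost Kenmotsu manifold with $h'\neq 0$. Suppose that $M$ admits a quasi Yamabe soliton $(g,V,\lambda,\alpha)$ whose soliton vector field $V$ is pointwise collinear with $\xi$ (that is, $V=b\xi$ for some smooth function $b$ on $M$). Then: (1) $V$ is a constant multiple of $\xi$; (2) $V$ is a strict infinitesimal contact transformation, i.e. $\pounds_V\eta=0$; (3) $(\pounds_V h')X=0$ for any vector field $X$ on $M$.
   Context: An almost contact metric manifold is a $(2n+1)$-dimensional smooth manifold $M$ with a structure $(\phi,\xi,\eta,g)$, where $\phi$ is a $(1,1)$-tensor field, $\xi$ a unit vector field, $\eta$ a 1-form and $g$ a Riemannian metric, satisfying $\phi^2=-I+\eta\otimes\xi$, $\eta(\xi)=1$, $\phi\xi=0$, $\eta\circ\phi=0$, and $g(\phi X,\phi Y)=g(X,Y)-\eta(X)\eta(Y)$ for all vector fields $X,Y$. Its fundamental 2-form is $\Phi(X,Y)=g(X,\phi Y)$. It is called an almost Kenmotsu manifold if $d\eta=0$ and $d\Phi=2\eta\wedge\Phi$. $\pounds$ denotes the Lie derivative. On an almost Kenmotsu manifold put $h=\frac12\pounds_\xi\phi$ and $h'=h\circ\phi$ (both $(1,1)$-tensor fields). Let $\nabla$ be the Levi-Civita connection of $g$ and $R(X,Y)Z=\nabla_X\nabla_YZ-\nabla_Y\nabla_XZ-\nabla_{[X,Y]}Z$ its curvature tensor. For real numbers $k,\mu$, the $(k,\mu)'$-nullity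 distribution is defined at each $p\in M$ by $$N_p(k,\mu)'=\{Z\in T_pM: R(X,Y)Z=k[g(Y,Z)X-g(X,Z)Y]+\mu[g(Y,Z)h'X-g(X,Z)h'Y]\ \text{for all } X,Y\in T_pM\}.$$ A $(k,\mu)'$-almost Kenmotsu manifold is an almost Kenmotsu manifold whose vector field $\xi$ belongs to the $(k,\mu)'$-nullity distribution, i.e. $$R(X,Y)\xi=k[\eta(Y)X-\eta(X)Y]+\mu[\eta(Y)h'X-\eta(X)h'Y]$$ for all vector fields $X,Y$, with $k,\mu\in\mathbb{R}$ constants. A Riemannian manifold $(M,g)$ with scalar curvature $r$ admits a quasi Yamabe soliton $(g,V,\lambda,\alpha)$ if $V$ is a smooth vector field, $\lambda$ is a constant and $\alpha$ is a smooth function on $M$ such that $$\tfrac12(\pounds_Vg)(X,Y)=(r-\lambda)g(X,Y)+\alpha V^{\#}(X)V^{\#}(Y)$$ for all vector fields $X,Y$, where $V^{\#}$ is the 1-form dual to $V$, $V^{\#}(X)=g(V,X)$. A vector field $V$ on an almost contact metric manifold $(M,\phi,\xi,\eta,g)$ is an infinitesimal contact transformation if $\pounds_V\eta=f\eta$ for some smooth function $f$ on $M$; it is a strict infinitesimal contact transformation if $f=0$. *)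

(* Defs.v *)
From HB Require Import structures.
From mathcomp Require Import all_boot all_order all_algebra.
From mathcomp Require Import all_classical all_reals all_analysis.
From mathcomp Require Import ring.
Set Implicit Arguments.
Unset Strict Implicit.
Unset Printing Implicit Defensive.
Import Order.TTheory GRing.Theory Num.Theory.
Import numFieldNormedType.Exports.
Local Open Scope classical_set_scope.
Local Open Scope ring_scope.

(* f is of class C^k on U. It is meant for open U, so that the values of f   *)
(* outside U are irrelevant. In finite dimension the differential of f is    *)
(* C^k iff all the directional derivatives 'D_v f are.                       *)
Fixpoint Ck_on (R : realType) (V W : normedModType R) (k : nat) (U : set V)
    (f : V -> W) : Prop :=
  match k with
  | 0%N => forall x, U x -> {for x, continuous f}
  | k'.+1 => (forall x, U x -> differentiable f x) /\
             (forall v, Ck_on k' U ('D_v f))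
  end.

Definition smooth_on (R : realType) (V W : normedModType R) (U : set V)
    (f : V -> W) : Prop := forall k, Ck_on k U f.

(* A homeomorphism between an open set of M and an open set of R^m; the      *)
(* total functions chart_map and chart_inv are irrelevant outside these.     *)
Record chart (R : realType) (m : nat) (M : topologicalType) := Chart {
  chart_dom : set M;
  chart_map : M -> 'rV[R]_m;
  chart_inv : 'rV[R]_m -> M;
  chart_dom_open : open chart_dom;
  chart_cod_open : open (chart_map @` chart_dom);
  chart_mapK : forall p, chart_dom p -> chart_inv (chart_map p) = p;
  chart_map_cont : forall p, chart_dom p -> {for p, continuous chart_map};
  chart_inv_cont : forall x, (chart_map @` chart_dom) x ->
    {for x, continuous chart_inv}
}.

Record manifold (R : realType) (m : nat) := Manifold {
  carrier :> topologicalType;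
  manifold_hausdorff : hausdorff_space carrier;
  manifold_second_countable : @second_countable carrier;
  atlas : set (chart R m carrier);
  atlas_cover : forall p : carrier, exists2 c, atlas c & chart_dom c p;
  atlas_compat : forall c c', atlas c -> atlas c' ->
    smooth_on (chart_map c @` (chart_dom c `&` chart_dom c'))
              (chart_map c' \o chart_inv c)
}.

Definition smooth_fun (R : realType) (m : nat) (M : manifold R m)
    (f : M -> R) : Prop :=
  forall c, @atlas R m M c ->
    smooth_on (chart_map c @` chart_dom c) (f \o chart_inv c : _ -> R^o).

Section SmoothOnTheory.
Context (R : realType) (V : normedModType R).
Implicit Types (U : set V) (f g : V -> R^o).

Lemma near_eq_differentiable f g x :
  {near x, f =1 g} -> differentiable f x -> differentiable g x.
Proof.
move=> fg df.
have -> : g = f + (g - f) by rewrite addrC subrK.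
apply: differentiableD => //.
set h := g - f.
have hE y : h y = g y - f y by [].
have h0 : h \o shift x = cst (h x) + \0 +o_ 0 id.
  have hx : h x = 0 by rewrite hE (nbhs_singleton fg) subrr.
  apply/eqaddoP => _/posnumP[e].
  have : \forall y \near 0, h (y + x) = 0.
    have : \forall y \near x, h y = 0.
      by apply: filterS fg => y; rewrite hE => ->; rewrite subrr.
    by rewrite (near_shift 0) /= subr0.
  apply: filterS => y hy.
  rewrite !fctE /= hy hx addr0 subrr normr0 mulr_ge0//.
have c0 : continuous (\0 : V -> R^o) by move=> ?; exact: cvg_cst.
have d0 := diff_unique c0 h0.
by apply/diff_locallyP; rewrite d0.
Unshelve. all: by end_near.
Qed.

Lemma Ck_on_ext k U f g : open U -> (forall x, U x -> f x = g x) ->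
  Ck_on k U f -> Ck_on k U g.
Proof.
move=> oU.
have nfg (f' g' : V -> R^o) : (forall x, U x -> f' x = g' x) ->
    forall x, U x -> {near x, f' =1 g'}.
  move=> e x Ux; near=> y; apply: e; near: y; exact: open_nbhs_nbhs.
elim: k f g => [|k IH] f g fg /=.
  move=> cf x Ux; have := cf x Ux; rewrite /prop_for /continuous_at -fg //.
  by apply: cvg_trans; apply: near_eq_cvg; exact: nfg Ux.
move=> [df Df]; split => [x Ux|v].
  exact: near_eq_differentiable (nfg _ _ fg x Ux) (df x Ux).
by apply: IH (Df v) => x Ux; apply: near_eq_derive; exact: nfg Ux.
Unshelve. all: by end_near.
Qed.

Lemma Ck_onW k U f : Ck_on k.+1 U f -> Ck_on k U f.
Proof.
elim: k f => [|k IH] f [df Df].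
  by move=> x Ux; apply: differentiable_continuous; exact: df.
by split=> // v; apply: IH; exact: Df.
Qed.

Lemma Ck_on_cst k U (a : R^o) : open U -> Ck_on k U (cst a : V -> R^o).
Proof.
move=> oU; elim: k a => [a x _|k IH a]; first exact: cvg_cst.
split=> [x _|v]; first exact: differentiable_cst.
by apply: Ck_on_ext (IH 0) => // x _; rewrite derive_cst.
Qed.

Lemma Ck_onB k U f g : open U ->
  Ck_on k U f -> Ck_on k U g -> Ck_on k U (f - g).
Proof.
move=> oU; elim: k f g => [|k IH] f g.
  by move=> cf cg x Ux; apply: continuousB; [exact: cf|exact: cg].
move=> [df Df] [dg Dg]; split=> [x Ux|v].
  by apply: differentiableB; [exact: df|exact: dg].
apply: Ck_on_ext (IH _ _ (Df v) (Dg v)) => // x Ux.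
by rewrite deriveB//; apply: diff_derivable; [exact: df|exact: dg].
Qed.

Lemma Ck_onD k U f g : open U ->
  Ck_on k U f -> Ck_on k U g -> Ck_on k U (f + g).
Proof.
move=> oU cf cg; have -> : f + g = f - (cst 0 - g) by rewrite sub0r opprK.
by apply: Ck_onB => //; apply: Ck_onB => //; exact: Ck_on_cst.
Qed.

Lemma Ck_onM k U (f g : V -> R) : open U ->
  Ck_on k U (f : V -> R^o) -> Ck_on k U (g : V -> R^o) ->
  Ck_on k U (f * g : V -> R^o).
Proof.
move=> oU; elim: k f g => [|k IH] f g.
  by move=> cf cg x Ux; apply: continuousM; [exact: cf|exact: cg].
move=> cf cg; have [df Df] := cf; have [dg Dg] := cg; split=> [x Ux|v].
  by apply: differentiableM; [exact: df|exact: dg].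
have cfD := IH _ _ (Ck_onW cf) (Dg v).
have cgD := IH _ _ (Ck_onW cg) (Df v).
apply: Ck_on_ext (Ck_onD oU cfD cgD) => // x Ux.
by rewrite deriveM//; apply: diff_derivable; [exact: df|exact: dg].
Qed.

End SmoothOnTheory.

Fact derivation_submod_id (A : comPzRingType) (h f g df dg ef eg : A) :
  h * (df * g + f * dg) + (ef * g + f * eg)
  = (h * df + ef) * g + f * (h * dg + eg).
Proof. ring. Qed.

Fact lie_derivation_id (A : comPzRingType)
    (f g xf xg yf yg xyf yxf xyg yxg : A) :
  xyf * g + yf * xg + (xf * yg + f * xyg)
  - (yxf * g + xf * yg + (yf * xg + f * yxg))
  = (xyf - yxf) * g + f * (xyg - yxg).
Proof. ring. Qed.

Section SmoothFunctions.
Context (R : realType) (m : nat) (M : manifold R m).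

Record cinf := Cinf { cinf_fun :> M -> R; _ : `[< smooth_fun cinf_fun >] }.

HB.instance Definition _ := [isSub for cinf_fun].
HB.instance Definition _ := [Choice of cinf by <:].

Fact smooth_fun_subring :
  subring_closed (fun f : M -> R => `[< smooth_fun f >]).
Proof.
split=> [|f g /asboolP sf /asboolP sg|f g /asboolP sf /asboolP sg];
  apply/asboolP => c Ac k.
- exact/Ck_on_cst/chart_cod_open.
- exact: (@Ck_onB R _ k _ (f \o chart_inv c) (g \o chart_inv c)
    (@chart_cod_open _ _ _ c) (sf c Ac k) (sg c Ac k)).
- exact: (@Ck_onM R _ k _ (f \o chart_inv c) (g \o chart_inv c)
    (@chart_cod_open _ _ _ c) (sf c Ac k) (sg c Ac k)).
Qed.

HB.instance Definition _ :=
  GRing.SubChoice_isSubComPzRing.Build _ _ cinf smooth_fun_subring.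

Fact smooth_cst (a : R) : `[< smooth_fun (cst a : M -> R) >].
Proof. by apply/asboolP => c Ac k; exact/Ck_on_cst/chart_cod_open. Qed.

Definition cinf_cst (a : R) : cinf := Cinf (smooth_cst a).

(* A vector field is a derivation of the R-algebra of smooth functions:      *)
(* X f is the function p |-> X_p f.                                          *)
Definition derivation (D : cinf -> cinf^o) : Prop :=
  [/\ forall f g, D (f + g) = D f + D g,
      forall a f, D (cinf_cst a * f) = cinf_cst a * D f
    & forall f g, D (f * g) = D f * g + f * D g].

Record vfield :=
  VField { vfield_fun :> cinf -> cinf^o; _ : `[< derivation vfield_fun >] }.

HB.instance Definition _ := [isSub for vfield_fun].
HB.instance Definition _ := [Choice of vfield by <:].

Fact derivation_submod :
  submod_closed (fun D : cinf -> cinf^o => `[< derivation D >]).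
Proof.
split=> [|h D E /asboolP[Da Dz Dm] /asboolP[Ea Ez Em]]; apply/asboolP.
  change (derivation (fun=> 0 : cinf)).
  by split=> *; rewrite ?addr0 ?mulr0 ?mul0r ?addr0.
change (derivation (fun f => h * D f + E f : cinf)).
split=> [f g|a f|f g].
- by rewrite Da Ea mulrDr addrACA.
- by rewrite Dz Ez mulrDr mulrCA.
- by rewrite Dm Em; exact: derivation_submod_id.
Qed.

HB.instance Definition _ :=
  GRing.SubChoice_isSubLmodule.Build _ _ _ vfield
    (GRing.submod_closed_semi derivation_submod).

Fact lie_derivation (X Y : vfield) :
  `[< derivation (fun f => X (Y f) - Y (X f)) >].
Proof.
have /asboolP[Xa Xz Xm] := valP X; have /asboolP[Ya Yz Ym] := valP Y.
apply/asboolP; split=> [f g|a f|f g].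
- by rewrite Ya Xa Xa Ya opprD addrACA.
- by rewrite Yz Xz Xz Yz mulrBr.
- by rewrite Ym Xm !Xa !Ya !Xm !Ym; exact: lie_derivation_id.
Qed.

Definition lie (X Y : vfield) : vfield := VField (lie_derivation X Y).

(* Tensor fields are C^oo(M)-multilinear maps on vector fields.              *)
Definition one_form := {linear vfield -> cinf^o}.

(* X_p <> 0 as a derivation at p. *)
Definition vf_nonzero_at (p : M) (X : vfield) : Prop :=
  exists f : cinf, X f p != 0.

Record riemannian_metric := RiemannianMetric {
  riem :> vfield -> vfield -> cinf;
  riem_sym : forall X Y, riem X Y = riem Y X;
  riem_linear : forall f X Y Z,
    riem (f *: X + Y) Z = f * riem X Z + riem Y Z;
  riem_pos : forall p X, vf_nonzero_at p X -> 0 < riem X X p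
}.

Definition lie_form (V : vfield) (w : vfield -> cinf) (X : vfield) : cinf :=
  V (w X) - w (lie V X).

Definition lie_endo (V : vfield) (T : vfield -> vfield) (X : vfield) : vfield :=
  lie V (T X) - T (lie V X).

Definition lie_form2 (V : vfield) (b : vfield -> vfield -> cinf)
    (X Y : vfield) : cinf :=
  V (b X Y) - b (lie V X) Y - b X (lie V Y).

Definition ext_d1 (w : vfield -> cinf) (X Y : vfield) : cinf :=
  X (w Y) - Y (w X) - w (lie X Y).

(* The other common normalization divides both ext_d2 and wedge12 by 3, so   *)
(* that equations between the two do not depend on the convention.           *)
Definition ext_d2 (b : vfield -> vfield -> cinf) (X Y Z : vfield) : cinf :=
  X (b Y Z) - Y (b X Z) + Z (b X Y)
  - b (lie X Y) Z + b (lie X Z) Y - b (lie Y Z) X.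

Definition wedge12 (w : vfield -> cinf) (b : vfield -> vfield -> cinf)
    (X Y Z : vfield) : cinf :=
  w X * b Y Z - w Y * b X Z + w Z * b X Y.

Record connection := Connection {
  nabla :> vfield -> vfield -> vfield;
  nabla_linear : forall f X Y Z,
    nabla (f *: X + Y) Z = f *: nabla X Z + nabla Y Z;
  nabla_add : forall X Y Z, nabla X (Y + Z) = nabla X Y + nabla X Z;
  nabla_leibniz : forall f X Y,
    nabla X (f *: Y) = (X f : cinf) *: Y + f *: nabla X Y
}.

Definition levi_civita (g : riemannian_metric) (D : connection) : Prop :=
  (forall X Y : vfield, D X Y - D Y X = lie X Y) /\
  (forall X Y Z : vfield, X (g Y Z) = g (D X Y) Z + g Y (D X Z)).

Definition curvature (D : connection) (X Y Z : vfield) : vfield :=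
  D X (D Y Z) - D Y (D X Z) - D (lie X Y) Z.

Definition orthonormal_at (g : riemannian_metric) (p : M)
    (E : 'I_m -> vfield) : Prop :=
  forall i j, g (E i) (E j) p = (i == j)%:R.

(* The trace of the Ricci tensor Ric(Y, Z) = tr (X |-> R(X, Y) Z). The sum   *)
(* does not depend on the frame orthonormal at p.                            *)
Definition scalar_curvature (g : riemannian_metric) (D : connection)
    (p : M) : R :=
  get [set s | exists2 E, orthonormal_at g p E &
    s = \sum_(i < m) \sum_(j < m) g (curvature D (E j) (E i) (E i)) (E j) p].

Definition quasi_yamabe_soliton (g : riemannian_metric) (D : connection)
    (V : vfield) (lambda : R) (alpha : cinf) : Prop :=
  forall X Y p,
    2^-1 * lie_form2 V g X Y p
    = (scalar_curvature g D p - lambda) * g X Y p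
      + alpha p * g V X p * g V Y p.

Definition infinitesimal_contact (eta : vfield -> cinf) (V : vfield)
    (f : cinf) : Prop :=
  forall X, lie_form V eta X = f * eta X.

Definition strict_infinitesimal_contact (eta : vfield -> cinf) (V : vfield) :=
  infinitesimal_contact eta V 0.

End SmoothFunctions.

Record almost_contact_metric (R : realType) (n : nat)
    (M : manifold R (2 * n).+1%N) := AlmostContactMetric {
  phi : {linear vfield M -> vfield M};
  xi : vfield M;
  eta : one_form M;
  gm : riemannian_metric M;
  phi_sqr : forall X, phi (phi X) = - X + (eta X : cinf M) *: xi;
  eta_xi : eta xi = 1 :> cinf M;
  phi_xi : phi xi = 0;
  eta_phi : forall X, eta (phi X) = 0;
  xi_unit : gm xi xi = 1;
  gm_phi : forall X Y,
    gm (phi X) (phi Y) = gm X Y - (eta X : cinf M) * (eta Y : cinf M)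
}.

Section AlmostKenmotsu.
Context (R : realType) (n : nat) (M : manifold R (2 * n).+1%N).
Context (S : almost_contact_metric M).

Definition fundamental_form (X Y : vfield M) : cinf M := gm S X (phi S Y).

Definition almost_kenmotsu : Prop :=
  (forall X Y, ext_d1 (eta S) X Y = 0) /\
  (forall X Y Z, ext_d2 fundamental_form X Y Z
                 = 2 * wedge12 (eta S) fundamental_form X Y Z).

Definition h_tensor (X : vfield M) : vfield M :=
  cinf_cst M 2^-1 *: lie_endo (xi S) (phi S) X.

Definition h'_tensor (X : vfield M) : vfield M := h_tensor (phi S X).

(* Z is a section of the (k, mu)'-nullity distribution. Both sides being     *)
(* tensorial in X and Y, this is the pointwise condition at every point.     *)
Definition in_nullity' (D : connection M) (k mu : R) (Z : vfield M) : Prop :=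
  forall X Y, curvature D X Y Z
    = cinf_cst M k *: (gm S Y Z *: X - gm S X Z *: Y)
    + cinf_cst M mu *: (gm S Y Z *: h'_tensor X - gm S X Z *: h'_tensor Y).

End AlmostKenmotsu.

(* Main.v *)
Require Import Defs.
From mathcomp Require Import all_boot all_order all_algebra.
From mathcomp Require Import all_classical all_reals all_analysis.
From mathcomp Require Import ring lra.
Set Implicit Arguments.
Unset Strict Implicit.
Unset Printing Implicit Defensive.
Import Order.TTheory GRing.Theory Num.Theory.
Import numFieldNormedType.Exports.
Local Open Scope classical_set_scope.
Local Open Scope ring_scope.

(** The soliton field is in fact zero, and the three conclusions follow.

    Write [A X] for [nabla_X xi]. The equations [d eta = 0] and
    [d Phi = 2 eta /\ Phi] give [A X = X - eta X xi + h' X] ([nabla_xiE]), where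
    [h'] is symmetric, kills [xi] and anticommutes with [phi]; moreover [phi] is
    parallel along [xi] ([nabla_phi_xi]). The nullity condition for
    [R(X, xi) xi] is then a Riccati equation for [h'], and comparing it with its
    conjugate by [phi] leaves [h'^2 = (k + 1) phi^2] ([h'_sqr]). As [h'] is not
    zero, [k <> -1].

    For [V = b xi] the soliton equation on vectors orthogonal to [xi] says that
    [b (1 + h')] is a multiple of the identity. Since [h'] anticommutes with
    [phi], this forces [b h' = 0], hence [b phi^2 = 0] by the formula for [h'^2]
    ([soliton_phi]).

    To conclude that [b] vanishes at every point [p], some vector field [X] with
    [phi X] nonzero at [p] is needed. The fact that [h'] is nonzero somewhere
    does not provide one at [p], which may lie in another component, but the
    dimension does: for [n > 0] bump functions and coordinate derivations yield
    two independent vector fields at [p] ([local_frame]), and only one direction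
    is spanned by [xi] ([exists_phi_neq0]). Finally [n = 0] is excluded because
    [h' X] is orthogonal to [xi], which is impossible for a nonzero field on a
    1-dimensional manifold ([dim1_orthogonal]).

    Vector fields being derivations, the last two points require some analysis:
    the smoothness of [exp (- 1 / t)] extended by zero ([flat_exp_smooth]) for
    bump functions, and that of the difference quotients of a smooth function
    ([taylor_quot_smooth]) for Hadamard's lemma. *)

(** * Smooth functions, vector fields and the metric *)

Section FieldCalculus.
Context (R : realType) (m : nat) (M : manifold R m).
Implicit Types (f : cinf M) (X Y Z W : vfield M) (p : M).

Lemma cinf_ext f1 f2 : (forall p, f1 p = f2 p) -> f1 = f2.
Proof. by move=> e; apply: val_inj; apply/funext. Qed.

Lemma vfield_ext X Y : (forall f, X f = Y f) -> X = Y.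
Proof. by move=> e; apply: val_inj; apply/funext. Qed.

Lemma cinfDE f1 f2 p : (f1 + f2) p = f1 p + f2 p. Proof. by []. Qed.
Lemma cinfBE f1 f2 p : (f1 - f2) p = f1 p - f2 p. Proof. by []. Qed.
Lemma cinfME f1 f2 p : (f1 * f2) p = f1 p * f2 p. Proof. by []. Qed.
Lemma cinf0E p : (0 : cinf M) p = 0. Proof. by []. Qed.
Lemma cinf1E p : (1 : cinf M) p = 1. Proof. by []. Qed.
Lemma cinfNE f1 p : (- f1) p = - f1 p. Proof. by []. Qed.
Lemma cinf_cstE (a : R) p : cinf_cst M a p = a. Proof. by []. Qed.
Lemma vfieldDE X Y f : (X + Y) f = X f + Y f :> cinf M. Proof. by []. Qed.
Lemma vfieldNE X f : (- X) f = - (X f) :> cinf M. Proof. by []. Qed.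
Lemma vfieldZE f1 X f : (f1 *: X) f = f1 * X f :> cinf M. Proof. by []. Qed.
Lemma vfield0E f : (0 : vfield M) f = 0 :> cinf M. Proof. by []. Qed.

Lemma vfieldD X f1 f2 : X (f1 + f2) = X f1 + X f2 :> cinf M.
Proof. by have /asboolP[+ _ _] := valP X; exact. Qed.
Lemma vfieldZ X a f : X (cinf_cst M a * f) = cinf_cst M a * X f :> cinf M.
Proof. by have /asboolP[_ + _] := valP X; exact. Qed.
Lemma vfieldM X f1 f2 : X (f1 * f2) = X f1 * f2 + f1 * X f2 :> cinf M.
Proof. by have /asboolP[_ _ +] := valP X; exact. Qed.
Lemma vfield_0 X : X 0 = 0 :> cinf M.
Proof. by apply: (addrI (X 0 : cinf M)); rewrite -vfieldD !addr0. Qed.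
Lemma vfieldN X f : X (- f) = - X f :> cinf M.
Proof. by apply: (addrI (X f : cinf M)); rewrite -vfieldD !subrr vfield_0. Qed.
Lemma vfieldB X f1 f2 : X (f1 - f2) = X f1 - X f2 :> cinf M.
Proof. by rewrite vfieldD vfieldN. Qed.
Lemma vfield_1 X : X 1 = 0 :> cinf M.
Proof.
apply: (addrI (X 1 : cinf M)); rewrite addr0 -[RHS](congr1 X (mulr1 1)).
by rewrite vfieldM !mulr1 mul1r.
Qed.
Lemma vfield_cst X a : X (cinf_cst M a) = 0 :> cinf M.
Proof. by rewrite -[cinf_cst M a]mulr1 vfieldZ vfield_1 mulr0. Qed.
Lemma vfieldM_at X f1 f2 p : f1 p = 0 ->
  (X (f1 * f2) : cinf M) p = (X f1 : cinf M) p * f2 p.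
Proof. by move=> f0; rewrite vfieldM cinfDE !cinfME f0 mul0r addr0. Qed.
End FieldCalculus.

Section Riem.
Context (R : realType) (m : nat) (M : manifold R m) (g : riemannian_metric M).
Implicit Types (f : cinf M) (X Y Z W : vfield M) (p : M).

Lemma riemDl X Y Z : g (X + Y) Z = g X Z + g Y Z.
Proof. by have := riem_linear g 1 X Y Z; rewrite scale1r mul1r. Qed.
Lemma riem0l Z : g 0 Z = 0.
Proof. by apply: (addrI (g 0 Z)); rewrite -riemDl !addr0. Qed.
Lemma riemZl f X Z : g (f *: X) Z = f * g X Z.
Proof. by have := riem_linear g f X 0 Z; rewrite riem0l !addr0. Qed.
Lemma riemNl X Z : g (- X) Z = - g X Z.
Proof. by rewrite -scaleN1r riemZl mulN1r. Qed.
Lemma riemDr X Y Z : g Z (X + Y) = g Z X + g Z Y.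
Proof. by rewrite riem_sym riemDl !(riem_sym g Z). Qed.
Lemma riem0r Z : g Z 0 = 0. Proof. by rewrite riem_sym riem0l. Qed.
Lemma riemZr f X Z : g Z (f *: X) = f * g Z X.
Proof. by rewrite riem_sym riemZl riem_sym. Qed.
Lemma riemNr X Z : g Z (- X) = - g Z X.
Proof. by rewrite riem_sym riemNl riem_sym. Qed.
Definition riemE :=
  (riemDl, riemDr, riemNl, riemNr, riemZl, riemZr, riem0l, riem0r).

Lemma riem_eq0_at X p f : g X X p = 0 -> X f p = 0.
Proof.
move=> g0; apply/eqP; apply/negPn/negP => Xf.
by have := @riem_pos _ _ _ g p X (ex_intro _ f Xf); rewrite g0 ltxx.
Qed.
Lemma riem_eq0 X : g X X = 0 -> X = 0.
Proof.
move=> g0; apply: vfield_ext => f; apply: cinf_ext => p.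
by apply: riem_eq0_at; rewrite g0.
Qed.
(** Turns an equation between vector fields into one between smooth functions,
    where ring identities can be decided. *)
Lemma riem_inj X Y : (forall Z, g X Z = g Y Z) -> X = Y.
Proof.
move=> e; apply/eqP; rewrite -subr_eq0; apply/eqP/riem_eq0.
by rewrite riemDl riemNl e subrr.
Qed.
End Riem.

(** Reduces an equation that follows linearly from others to a ring identity. *)
Lemma eq_of_eq (A : zmodType) (a b c d : A) : a = b -> c - d = a - b -> c = d.
Proof. by move=> -> /eqP; rewrite subrr subr_eq0 => /eqP. Qed.
Lemma eq_of_eqs (A : zmodType) (a b c d e f : A) :
  a = b -> c = d -> e - f = a - b + (c - d) -> e = f.
Proof. by move=> -> -> /eqP; rewrite !subrr addr0 subr_eq0 => /eqP. Qed.

Section LieBracket.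
Context (R : realType) (m : nat) (M : manifold R m).
Implicit Types (f : cinf M) (X Y Z W : vfield M) (p : M).

Lemma lieE X Y f : lie X Y f = X (Y f) - Y (X f) :> cinf M. Proof. by []. Qed.
Lemma lieDr X Y Z : lie X (Y + Z) = lie X Y + lie X Z.
Proof.
by apply: vfield_ext => f; rewrite !(lieE, vfieldDE) vfieldD opprD addrACA.
Qed.
Lemma lieZr X f Y : lie X (f *: Y) = (X f : cinf M) *: Y + f *: lie X Y.
Proof.
apply: vfield_ext => u.
by rewrite !(lieE, vfieldDE, vfieldZE) vfieldM; ring.
Qed.
Lemma lieNr X Y : lie X (- Y) = - lie X Y.
Proof.
by apply: vfield_ext => f; rewrite !(lieE, vfieldNE) vfieldN opprD.
Qed.
Lemma lie0l X : lie 0 X = 0.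
Proof.
by apply: vfield_ext => f; rewrite lieE vfield0E vfield_0 subr0.
Qed.
Lemma liexx X : lie X X = 0.
Proof. by apply: vfield_ext => f; rewrite lieE subrr. Qed.
End LieBracket.

Section Connection.
Context (R : realType) (m : nat) (M : manifold R m) (D : connection M).
Implicit Types (f : cinf M) (X Y Z : vfield M).

Lemma nablaDl X Y Z : D (X + Y) Z = D X Z + D Y Z.
Proof. by have := nabla_linear D 1 X Y Z; rewrite !scale1r. Qed.
Lemma nabla0l Z : D 0 Z = 0.
Proof. by apply: (addrI (D 0 Z)); rewrite -nablaDl !addr0. Qed.
Lemma nablaZl f X Z : D (f *: X) Z = f *: D X Z.
Proof. by have := nabla_linear D f X 0 Z; rewrite nabla0l !addr0. Qed.
Lemma nablaNl X Z : D (- X) Z = - D X Z.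
Proof. by rewrite -scaleN1r nablaZl scaleN1r. Qed.
Lemma nabla0r X : D X 0 = 0.
Proof. by apply: (addrI (D X 0)); rewrite -nabla_add !addr0. Qed.
Lemma nablaNr X Z : D X (- Z) = - D X Z.
Proof. by apply: (addrI (D X Z)); rewrite -nabla_add !subrr nabla0r. Qed.
End Connection.

(** * The algebra of nabla xi and h' on an almost Kenmotsu manifold *)

Section AlmostKenmotsu.
Context (R : realType) (n : nat) (M : manifold R (2 * n).+1%N).
Context (S : almost_contact_metric M) (D : connection M).
Local Notation g := (gm S).
Local Notation xi := (xi S).
Local Notation eta := (eta S).
Local Notation phi := (phi S).
Local Notation h := (h_tensor S).
Local Notation h' := (h'_tensor S).
Implicit Types (f : cinf M) (X Y Z W : vfield M) (p : M).

Lemma halfK f : cinf_cst M 2^-1 * (2 * f) = f.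
Proof.
apply: cinf_ext => p; change (2^-1 * ((1 + 1) * f p) = f p).
by field.
Qed.

Lemma eta_riem X : eta X = g X xi.
Proof.
have := gm_phi S X xi; rewrite phi_xi riem0r eta_xi mulr1 => /esym/eqP.
by rewrite subr_eq0 => /eqP.
Qed.
Lemma phiD X Y : phi (X + Y) = phi X + phi Y. Proof. exact: linearD. Qed.
Lemma phiN X : phi (- X) = - phi X. Proof. exact: linearN. Qed.
Lemma phiZ f X : phi (f *: X) = f *: phi X. Proof. exact: linearZ. Qed.
Lemma riem_xi_phi X : g xi (phi X) = 0.
Proof. by rewrite riem_sym -eta_riem eta_phi. Qed.
Lemma phi_skew X Y : g (phi X) Y = - g X (phi Y).
Proof.
have := gm_phi S X (phi Y).
rewrite phi_sqr eta_phi !riemE (riem_sym _ (phi X) xi) riem_xi_phi => e.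
have : g X (phi Y) = g X (phi Y) - (eta X : cinf M) * 0 by ring.
by rewrite -e => ->; ring.
Qed.

Hypotheses (LC : levi_civita g D) (AK : almost_kenmotsu S).
Local Notation A X := (D X xi).

Lemma lie_nabla X Y : lie X Y = D X Y - D Y X. Proof. by rewrite LC.1. Qed.
Lemma metric_nabla X Y Z : X (g Y Z) = g (D X Y) Z + g Y (D X Z) :> cinf M.
Proof. exact: LC.2. Qed.

Lemma riem_nabla_xi X : g (A X) xi = 0.
Proof.
have := metric_nabla X xi xi; rewrite xi_unit vfield_1 (riem_sym g xi) => e.
by rewrite -[LHS]halfK mulrDl mul1r -e mulr0.
Qed.
(** This is the closedness of [eta], the 1-form dual to [xi]. *)
Lemma nabla_xi_sym X Y : g (A X) Y = g X (A Y).
Proof.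
have := AK.1 X Y; rewrite /ext_d1 !eta_riem lie_nabla !metric_nabla !riemE => e.
rewrite (riem_sym g (A X)); apply/eqP; rewrite -subr_eq0 -e; apply/eqP; ring.
Qed.
Lemma nabla_xi_xi : A xi = 0.
Proof.
apply: (riem_inj (g := g)) => Z.
by rewrite nabla_xi_sym riem_sym riem_nabla_xi riem0l.
Qed.

(** Contracting [d Phi = 2 eta /\ Phi] with [xi] says that the Lie derivative of
    [Phi] along [xi] is [2 Phi]. As [Phi Y Z = g Y (phi Z)], this derivative is
    made of that of [g], which is [2 g (A Y) Z] by symmetry of [A], and that of
    [phi], which is [2 h]. *)
Lemma h_nablaE Z : h Z = phi Z - A (phi Z).
Proof.
apply: (riem_inj (g := g)) => Y; rewrite /h_tensor !riemE.
rewrite -[RHS]halfK; congr (_ * _).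
have := AK.2 xi Y Z.
(* contraction with xi kills every term where xi is an argument of Phi *)
rewrite /ext_d2 /wedge12 /fundamental_form !riem_xi_phi !vfield_0 phi_xi riem0r.
rewrite eta_xi metric_nabla (lie_nabla xi Y) /lie_endo !lie_nabla.
rewrite linearB /= !riemE !phi_skew.
rewrite nabla_xi_sym (_ : g Y (phi Z) = - g Z (phi Y)) => [E|].
  rewrite (riem_sym g _ Y) (riem_sym g _ Y).
  by apply: (eq_of_eq E); ring.
by rewrite riem_sym phi_skew.
Qed.

Lemma h'_nablaE Z : h' Z = A Z - Z + (eta Z : cinf M) *: xi.
Proof.
rewrite /h'_tensor h_nablaE phi_sqr nablaDl nablaNl nablaZl nabla_xi_xi scaler0.
by rewrite addr0 opprK addrC addrA.
Qed.
Lemma nabla_xiE Z : A Z = Z - (eta Z : cinf M) *: xi + h' Z.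
Proof.
by rewrite h'_nablaE; apply: (riem_inj (g := g)) => W; rewrite !riemE; ring.
Qed.

Lemma h'_is_linear : linear h'.
Proof.
move=> f X Y; rewrite !h'_nablaE nablaDl nablaZl !eta_riem.
by apply: (riem_inj (g := g)) => W; rewrite !riemE; ring.
Qed.
Lemma h'D X Y : h' (X + Y) = h' X + h' Y.
Proof. by have := h'_is_linear 1 X Y; rewrite !scale1r. Qed.
Lemma h'0 : h' 0 = 0.
Proof. by apply: (addrI (h' 0)); rewrite -h'D !addr0. Qed.
Lemma h'Z f X : h' (f *: X) = f *: h' X.
Proof. by have := h'_is_linear f X 0; rewrite h'0 !addr0. Qed.
Lemma h'N X : h' (- X) = - h' X.
Proof. by rewrite -scaleN1r h'Z scaleN1r. Qed.

Lemma h'_xi : h' xi = 0.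
Proof. by rewrite h'_nablaE nabla_xi_xi eta_xi scale1r sub0r addNr. Qed.
Lemma eta_h' X : eta (h' X) = 0.
Proof.
rewrite h'_nablaE eta_riem !riemE riem_nabla_xi xi_unit -eta_riem; ring.
Qed.
Lemma h'_sym X Y : g (h' X) Y = g X (h' Y).
Proof.
by rewrite !h'_nablaE !riemE nabla_xi_sym !eta_riem (riem_sym g xi); ring.
Qed.

(** The Lie derivative of [phi \o phi = - id + eta * xi] along [xi] vanishes,
    because [eta] is closed. *)
Lemma h_phi X : h (phi X) = - phi (h X).
Proof.
have L : lie_endo xi phi (phi X) = - phi (lie_endo xi phi X).
  rewrite /lie_endo linearB /= !phi_sqr lieDr lieNr lieZr liexx scaler0 addr0.
  have := AK.1 xi X; rewrite /ext_d1 eta_xi vfield_1 => E.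
  apply: (riem_inj (g := g)) => W; rewrite !riemE.
  by apply: (eq_of_eq (congr1 (fun f => f * g xi W) E)); ring.
by rewrite /h_tensor linearZ /= L scalerN.
Qed.
Lemma h'_phi X : h' (phi X) = - phi (h' X).
Proof. exact: h_phi. Qed.

Lemma phi_nabla_xi X : phi (A X) = phi X + phi (h' X).
Proof.
by rewrite nabla_xiE linearD linearB linearZ /= phi_xi scaler0 subr0.
Qed.
Lemma nabla_xi_phi X : A (phi X) = phi X - phi (h' X).
Proof. by rewrite nabla_xiE eta_phi scale0r subr0 h'_phi. Qed.

(** The field [phi] is parallel along [xi]: the covariant derivative differs
    from the Lie derivative [2 h] by the commutator of [A] and [phi], which
    cancels it. *)
Lemma nabla_phi_xi X : D xi (phi X) = phi (D xi X).
Proof.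
have := h_nablaE X; rewrite /h_tensor /lie_endo !lie_nabla (linearB phi) /=.
rewrite phi_nabla_xi nabla_xi_phi => E.
apply: (riem_inj (g := g)) => W; have := congr1 (fun Z => 2 * g Z W) E.
rewrite !riemE mulrA (mulrC 2) -mulrA halfK => {}E.
by apply: (eq_of_eq E); ring.
Qed.

Context (k mu : R) (N : in_nullity' S D k mu xi).

(** With [Y = xi] the nullity condition is the Riccati equation
    [nabla_xi A + A^2 = - k - mu h'] on the vectors orthogonal to [xi], where
    [A = 1 + h']. Conjugation by [phi] changes the sign of [h'] and of
    [nabla_xi h']; the part of the equation that it fixes is
    [1 + h'^2 = - k]. *)
Lemma h'_sqr X : h' (h' X) = cinf_cst M (k + 1) *: phi (phi X).
Proof.
have N0 Y : D xi (A Y) + A (A Y) - A (D xi Y)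
    = - (cinf_cst M k *: (Y - g Y xi *: xi) + cinf_cst M mu *: h' Y).
  have := N Y xi; rewrite /curvature nabla_xi_xi nabla0r xi_unit !scale1r h'_xi.
  rewrite scaler0 subr0 => <-; rewrite lie_nabla nablaDl nablaNl sub0r.
  by rewrite !opprD !opprK addrA.
have h'A Y : h' (A Y) = h' Y + h' (h' Y).
  by rewrite nabla_xiE !(h'D, h'N, h'Z) h'_xi scaler0 oppr0 addr0.
(* N1 composes the equation with phi on the left, N2 on the right; in their sum
   the terms that are odd in h' cancel *)
have := congr1 phi (N0 X); rewrite !(phiN, phiD) (phiZ (cinf_cst M k)).
rewrite (phiZ (cinf_cst M mu)) !(phiN, phiD) (phiZ (g X xi)) -nabla_phi_xi.
rewrite !phi_nabla_xi h'A phi_xi scaler0 subr0 phiD nabla_add => N1.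
have := N0 (phi X); rewrite -eta_riem eta_phi scale0r subr0.
rewrite [D xi (phi X)]nabla_phi_xi !nabla_xi_phi nabla_add nablaNr.
rewrite nablaDl nablaNl.
rewrite !nabla_xi_phi h'_phi scalerN => N2.
have phih'h' : phi X + phi (h' (h' X)) = - (cinf_cst M k *: phi X).
  apply: (riem_inj (g := g)) => W.
  have e1 := congr1 (g^~ W) N1; have e2 := congr1 (g^~ W) N2.
  rewrite -[LHS]halfK -[RHS]halfK; congr (_ * _).
  move: e1 e2; rewrite !riemE !nabla_phi_xi => e1 e2.
  by apply: (eq_of_eqs e1 e2); ring.
have := congr1 phi phih'h'.
rewrite phiD phiN (phiZ (cinf_cst M k)) (phi_sqr S (h' (h' X))) eta_h'.
rewrite scale0r addr0 => E.
apply: (riem_inj (g := g)) => W.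
have := congr1 (g^~ W) E; rewrite !riemE => {}E.
have cstD : cinf_cst M (k + 1) = cinf_cst M k + 1 by apply: cinf_ext.
by rewrite cstD; apply: (eq_of_eq (esym E)); ring.
Qed.

Lemma riem_h'_sqr X :
  g (h' X) (h' X) = - cinf_cst M (k + 1) * g (phi X) (phi X).
Proof. by rewrite h'_sym h'_sqr riemZr (phi_skew X (phi X)) mulrNN. Qed.

Context (lambda : R) (alpha b : cinf M).

(** For [V = b xi] the soliton equation on vectors orthogonal to [xi] reads
    [b * (g X Y + g (h' X) Y) = (r - lambda) * g X Y]. Applying [phi] to both
    vectors preserves [g] and changes the sign of the term in [h'], so this term
    is zero. *)
Lemma soliton_h' : quasi_yamabe_soliton g D (b *: xi) lambda alpha ->
  forall X, b * g (h' X) (h' X) = 0.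
Proof.
move=> QY.
have lieV X Y : lie_form2 (b *: xi) g (phi X) (phi Y)
    = 2 * (b * (g (phi X) (phi Y) + g (h' (phi X)) (phi Y))).
  rewrite h'_phi /lie_form2 vfieldZE metric_nabla !lie_nabla.
  have nV Z : D Z (b *: xi) = (Z b : cinf M) *: xi + b *: A Z.
    exact: nabla_leibniz.
  rewrite !nV !nablaZl !riemE !riem_xi_phi (riem_sym g (phi X) xi) riem_xi_phi.
  rewrite -(nabla_xi_sym (phi X)) !nabla_xi_phi !riemE; ring.
have half2 f p : 2^-1 * (2 * f) p = f p by rewrite -[in RHS](halfK f).
have sol X Y p : b p * (g (phi X) (phi Y) p + g (h' (phi X)) (phi Y) p)
    = (scalar_curvature g D p - lambda) * g (phi X) (phi Y) p.
  have := QY (phi X) (phi Y) p; rewrite lieV half2.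
  by rewrite !(riemZl g b) !riem_xi_phi !mulr0 addr0 => <-.
have bh' X Y : b * g (h' (phi X)) (phi Y) = 0.
  have phi2 Z : g (phi (phi X)) (phi Z) = g (phi X) Z.
    by rewrite gm_phi eta_phi mul0r subr0.
  have h2 : g (h' (phi (phi X))) (phi (phi Y)) = - g (h' (phi X)) (phi Y).
    by rewrite h'_phi riemNl gm_phi eta_h' mul0r subr0.
  apply: cinf_ext => p; have := sol (phi X) (phi Y) p; have := sol X Y p.
  rewrite phi2 h2 cinfNE cinfME => <- /eqP; rewrite cinf0E.
  rewrite -subr_eq0 -mulrBr opprD addrACA subrr add0r -opprD -mulr2n.
  by rewrite mulrN oppr_eq0 mulrnAr mulrn_eq0 => /eqP.
move=> X; have := bh' (phi X) (phi (h' X)).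
rewrite h'_phi h'_phi !phiN (phi_sqr S (h' X)) eta_h' scale0r addr0 opprK.
by rewrite riemNl riemNr opprK.
Qed.

(** If [k] were [-1], then [h'_sqr] would make [h'] vanish. *)
Lemma soliton_phi : (exists X, h' X <> 0) ->
  quasi_yamabe_soliton g D (b *: xi) lambda alpha ->
  forall X, b * g (phi X) (phi X) = 0.
Proof.
move=> [Y h'Y] QY X.
have k1 : k + 1 != 0.
  apply/negP => /eqP k1; apply: h'Y; apply: (riem_eq0 (g := g)).
  rewrite riem_h'_sqr k1 (_ : cinf_cst M 0 = 0) ?oppr0 ?mul0r//.
  exact: cinf_ext.
apply: cinf_ext => p; have := soliton_h' QY X; rewrite riem_h'_sqr mulrCA.
move=> /(congr1 (fun f : cinf M => f p)) /eqP.
have -> : (- cinf_cst M (k + 1) * (b * g (phi X) (phi X))) p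
  = - (k + 1) * (b * g (phi X) (phi X)) p by [].
by rewrite mulf_eq0 oppr_eq0 (negbTE k1) => /eqP.
Qed.
End AlmostKenmotsu.

(** * Calculus of C^k maps *)

Section CkCalculus.
Context (R : realType).
Implicit Types (V W : normedModType R).

(** Smoothness of a function extended by zero is checked separately inside the
    chart and away from the support. *)
Lemma Ck_on_local V W k (U : set V) (f : V -> W) :
  (forall x, U x -> exists2 U' : set V, U' x & Ck_on k U' f) -> Ck_on k U f.
Proof.
elim: k f => [|k IH] f Uf /=; first by move=> x /Uf[U' U'x]; apply.
split=> [x /Uf[U' U'x [+ _]]|v]; first exact.
by apply: IH => x /Uf[U' U'x [_ /(_ v)]]; exists U'.
Qed.

Lemma Ck_onW_vec V W k (U : set V) (f : V -> W) : Ck_on k.+1 U f -> Ck_on k U f.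
Proof.
elim: k f => [|k IH] f [df Df].
  by move=> x Ux; apply: differentiable_continuous; exact: df.
by split=> // v; apply: IH; exact: Df.
Qed.

Lemma Ck_on_sum V k (U : set V) n (f : 'I_n -> V -> R^o) : open U ->
  (forall i, Ck_on k U (f i)) -> Ck_on k U (\sum_i f i).
Proof.
move=> oU; elim: n f => [|n IH] f fU.
  rewrite big_ord0; have -> : 0 = cst 0 :> (V -> R^o) by [].
  exact: Ck_on_cst.
by rewrite big_ord_recl; apply: Ck_onD => //; apply: IH.
Qed.

Lemma Ck_on_coord V k n (U : set V) (f : V -> 'rV[R]_n) i : open U ->
  Ck_on k U f -> Ck_on k U (fun x => f x ord0 i : R^o).
Proof.
move=> oU; elim: k f => [|k IH] f /=.
  move=> cf x Ux; apply: (@continuous_comp _ _ _ f (fun M => M ord0 i)).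
    exact: cf.
  exact: coord_continuous.
move=> [df Df]; split=> [x Ux|v].
  apply: (@differentiable_comp _ _ _ _ f (fun M => M ord0 i : R^o)).
    exact: df.
  exact: differentiable_coord.
apply: Ck_on_ext (IH _ (Df v)) => // x Ux.
by rewrite derive_mx ?mxE//; apply: diff_derivable; exact: df.
Qed.

Lemma diff_rVE n (f : 'rV[R]_n -> R^o) x v : differentiable f x ->
  'd f x v = \sum_i v ord0 i * 'D_(delta_mx 0 i) f x.
Proof.
move=> df; rewrite [in LHS](row_sum_delta v) linear_sum.
by apply: eq_bigr => i _; rewrite linearZ /= deriveE.
Qed.

Lemma Ck_on_comp V k n (U : set V) (W : set 'rV[R]_n)
    (f : 'rV[R]_n -> R^o) (s : V -> 'rV[R]_n) :
  open U -> (forall x, U x -> W (s x)) ->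
  Ck_on k W f -> Ck_on k U s -> Ck_on k U (f \o s).
Proof.
move=> oU UW; elim: k f => [|k IH] f.
  by move=> cf cs x Ux; apply: continuous_comp; [exact: cs|exact/cf/UW].
move=> [df Df] cs; have [ds Ds] := cs; split=> [x Ux|v].
  by apply: differentiable_comp; [exact: ds|exact/df/UW].
have : Ck_on k U (\sum_i ((fun x => 'D_v s x ord0 i : R^o)
                          * ('D_(delta_mx 0 i) f \o s)) : V -> R^o).
  apply: Ck_on_sum => // i; apply: Ck_onM => //.
    by apply: Ck_on_coord => //; exact: Ds.
  by apply: IH (Df _) _; exact: Ck_onW_vec.
apply: Ck_on_ext => // x Ux.
have dfx := df _ (UW _ Ux); have dsx := ds _ Ux.
rewrite (deriveE v (differentiable_comp dsx dfx)) diff_comp//= diff_rVE//.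
rewrite fct_sumE; apply: eq_bigr => i _; by rewrite -deriveE.
Qed.

Lemma Ck_on_comp1 V k (U : set V) (W : set R^o)
    (f : R^o -> R^o) (s : V -> R^o) :
  open U -> (forall x, U x -> W (s x)) ->
  Ck_on k W f -> Ck_on k U s -> Ck_on k U (f \o s).
Proof.
move=> oU UW; elim: k f => [|k IH] f.
  by move=> cf cs x Ux; apply: continuous_comp; [exact: cs|exact/cf/UW].
move=> [df Df] cs; have [ds Ds] := cs; split=> [x Ux|v].
  by apply: differentiable_comp; [exact: ds|exact/df/UW].
have : Ck_on k U ('D_v s * (('D_(1 : R^o) f : R^o -> R^o) \o s) : V -> R^o).
  by apply: Ck_onM => //; [exact: Ds|exact: (IH _ (Df 1) (Ck_onW_vec cs))].
apply: Ck_on_ext => // x Ux.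
have dfx := df _ (UW _ Ux); have dsx := ds _ Ux.
rewrite (deriveE v (differentiable_comp dsx dfx)) diff_comp//=.
have -> : 'd s x v = ('d s x v : R) *: (1 : R^o) by rewrite [RHS]mulr1.
by rewrite linearZ /= -!deriveE.
Qed.

Lemma smooth_derive V W (U : set V) (f : V -> W) v :
  smooth_on U f -> smooth_on U ('D_v f).
Proof. by move=> sf k; have [_] := sf k.+1; exact. Qed.

Lemma smooth_of_cst_derive V W (U : set V) (f : V -> W) :
  (forall x, differentiable f x) -> (forall v, exists w, 'D_v f = cst w) ->
  smooth_on U f.
Proof.
move=> df Df k.
have Ck_cst w j : Ck_on j U (cst w : V -> W).
  elim: j w => [|j IH] w; first by move=> x _; exact: cvg_cst.
  split=> [x _|v]; first exact: differentiable_cst.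
  have -> : 'D_v (cst w) = cst 0 :> (V -> W).
    by apply/funext => x; rewrite derive_cst.
  exact: IH.
case: k => [|k]; first by move=> x _; exact: differentiable_continuous.
by split=> // v; have [w ->] := Df v; exact: Ck_cst.
Qed.

Lemma smooth_id V (U : set V) : smooth_on U (@id V).
Proof.
apply: smooth_of_cst_derive => [x|v]; first exact: (ex_diff (df := id)).
by exists v; apply/funext => x; rewrite derive_id.
Qed.

Lemma smooth_coord n (U : set 'rV[R]_n) i : open U ->
  smooth_on U (fun x => x ord0 i : R^o).
Proof. by move=> oU k; apply: Ck_on_coord => //; exact: smooth_id. Qed.

End CkCalculus.

(** * A smooth flat function *)

Section SmoothFamilies.
Context (R : realType).

(** If a family of functions is closed under differentiation, up to linear
    combinations, then once differentiable its members are smooth. Both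
    [flat_exp] and the Taylor quotients below belong to such a family whose
    members have a removable singularity, so that only first derivatives have
    to be examined there. *)
Lemma smooth_family (T : Type) (F : T -> R^o -> R^o) (s r : T -> T) (c : T -> R)
    (U : set R^o) : open U ->
  (forall t x, U x ->
    is_derive (x : R^o) (1 : R^o) (F t) (F (s t) x + c t * F (r t) x)) ->
  forall t, smooth_on U (F t).
Proof.
move=> oU dF t k.
have diffF t' x : U x -> differentiable (F t') x.
  by move=> Ux; apply/derivable1_diffP; have [] := dF t' x Ux.
elim: k t => [|k IH] t.
  by move=> x Ux; apply/differentiable_continuous/diffF.
split=> [x|v]; first exact: diffF.
have : Ck_on k U (cst v * (F (s t) + cst (c t) * F (r t)) : R^o -> R^o).
  by do ?[apply: Ck_onM | apply: Ck_onD | apply: Ck_on_cst | apply: IH].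
apply: Ck_on_ext => // x Ux.
have [_ d1] := dF t x Ux.
transitivity (v * ('D_(1 : R^o) (F t) x : R)); first by rewrite d1.
rewrite !deriveE; try exact: diffF.
rewrite [in RHS](_ : v = (v : R) *: (1 : R^o)); last by rewrite [RHS]mulr1.
by rewrite linearZ.
Qed.

(** Caratheodory's form of the derivative, used at removable singularities. *)
Lemma is_derive_slope (f G : R^o -> R^o) (a : R^o) :
  (forall x, f x = f a + (x - a) * G x) -> {for a, continuous G} ->
  is_derive a (1 : R^o) f (G a).
Proof.
move=> fG cG.
have : (h^-1 *: ((f \o shift a) (h *: (1 : R^o)) - f a)) @[h --> (0 : R^o)^']
    --> G a.
  have : G (h + a) @[h --> (0 : R^o)^'] --> G a.
    apply: cvg_within_filter.
    have sh : (h + a) @[h --> (0 : R^o)] --> (a : R^o).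
      rewrite -[X in _ --> X]add0r.
      by apply: cvgD; [exact: cvg_id|exact: cvg_cst].
    exact: (cvg_comp _ _ sh cG).
  apply: cvg_trans; apply: near_eq_cvg; near=> h.
  have h0 : h != 0 by near: h; exact: nbhs_dnbhs_neq.
  rewrite /= fG [h *: _]mulr1 addrAC subrr add0r addrK.
  by rewrite [RHS]mulrA mulVf ?mul1r.
move=> cvf; split; first by apply/cvg_ex; exists (G a).
exact: cvg_lim.
Unshelve. all: by end_near.
Qed.

(** The powers of [t^-1] are there to make the family closed under
    differentiation. *)
Definition flat_exp (n : nat) (t : R^o) : R^o :=
  if 0 < t then t^-1 ^+ n * expR (- t^-1) else 0.

(** With [N = n + 1], this is the bound [u ^ N <= exp u ^ N = exp (1 / t)] for
    [u = 1 / (N t)]. *)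
Lemma flat_exp_le n t : `|flat_exp n t| <= (n.+1)%:R ^+ n.+1 * `|t|.
Proof.
rewrite /flat_exp; case: ltP => t0; last by rewrite normr0 mulr_ge0.
rewrite !gtr0_norm//; last by rewrite mulr_gt0 ?expR_gt0// exprn_gt0 ?invr_gt0.
rewrite expRN -ler_pdivlMr ?invr_gt0 ?expR_gt0// invrK.
have -> : t^-1 = n.+1%:R * (n.+1%:R^-1 * t^-1) by rewrite mulrA mulfV ?mul1r.
rewrite expRM_natl exprMn -mulrA.
set u := _ / t.
have u0 : 0 < u by rewrite divr_gt0.
have -> : n.+1%:R ^+ n * u ^+ n = n.+1%:R ^+ n.+1 * (t * u ^+ n.+1).
  by rewrite !exprS /u; field; rewrite gt_eqF//= pnatr_eq0.
rewrite ler_wpM2l// ler_wpM2l ?(ltW t0)//.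
rewrite lerXn2r ?nnegrE ?expR_ge0 ?(ltW u0)//.
by apply: le_trans (expR_ge1Dx u); rewrite lerDr.
Qed.

Lemma flat_exp0 n t : t <= 0 -> flat_exp n t = 0.
Proof. by rewrite /flat_exp ltNge => ->. Qed.

Lemma flat_exp_gt0 n t : (0 < flat_exp n t) = (0 < t).
Proof.
rewrite /flat_exp; case: ifP => [t0|]; last by rewrite ltxx.
by rewrite mulr_gt0 ?expR_gt0// exprn_gt0// invr_gt0.
Qed.

Lemma flat_exp_continuous0 n : {for 0, continuous (flat_exp n)}.
Proof.
rewrite /prop_for /continuous_at flat_exp0//; apply/cvgrPdist_le => e e0.
set C : R := n.+1%:R ^+ n.+1; have C0 : 0 < C by rewrite exprn_gt0.
near=> t; rewrite sub0r normrN (le_trans (flat_exp_le _ _))// -/C.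
rewrite mulrC -ler_pdivlMr//.
by near: t; apply: (@nbhs0_le _ R^o); rewrite divr_gt0.
Unshelve. all: by end_near.
Qed.

Lemma flat_exp_derive n (t : R^o) :
  is_derive t (1 : R^o) (flat_exp n)
    (flat_exp n.+2 t + - n%:R * flat_exp n.+1 t).
Proof.
have [t0|t0|->] := ltgtP t 0.
- apply: (near_eq_is_derive (f := cst 0)).
    near=> s; rewrite flat_exp0//; apply: ltW; near: s.
    exact: lt_nbhsl.
  by rewrite !flat_exp0 ?(ltW t0)// mulr0 addr0; exact: is_derive_cst.
- apply: (near_eq_is_derive
      (f := (fun s : R => s^-1) ^+ n * (fun s : R => expR (- s^-1)))).
    near=> s; rewrite /flat_exp ifT ?mulrfctE ?exprfctE//; near: s.
    exact: lt_nbhsr.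
  rewrite /flat_exp t0.
  have tn0 : t != 0 by rewrite gt_eqF.
  have dV : is_derive t (1 : R) (fun s : R => s^-1) (- t ^- 2).
    by apply: is_derive_eq (@is_deriveV R id t 1 1 tn0 _) _; rewrite [LHS]mulr1.
  have dE : is_derive t (1 : R) (fun s : R => expR (- s^-1))
      (expR (- t^-1) * t ^- 2).
    apply: (@is_derive1_comp R expR (fun s => - s^-1)).
    by rewrite -[t ^- 2]opprK; exact: is_deriveN.
  have dX := @is_deriveX _ _ _ n _ _ _ dV.
  apply: is_derive_eq (@is_deriveM _ _ _ _ _ _ _ _ dX dE) _.
  rewrite -exprVn exprfctE.
  change (t^-1 ^+ n * (expR (- t^-1) * t^-1 ^+ 2) +
    expR (- t^-1) * ((n%:R * t^-1 ^+ n.-1) * - (t^-1 ^+ 2)) =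
    t^-1 ^+ n.+2 * expR (- t^-1) + - n%:R * (t^-1 ^+ n.+1 * expR (- t^-1))).
  move: (t^-1) (expR _) => u E.
  by case: (n) => [|j]; rewrite /= !exprS; ring.
- apply: is_derive_eq.
    apply: (@is_derive_slope _ (flat_exp n.+1)); last first.
      exact: flat_exp_continuous0.
    move=> s; rewrite (@flat_exp0 n 0)// add0r subr0 /flat_exp.
    case: ifP => s0; last by rewrite mulr0.
    by rewrite exprS mulrA mulrA mulfV ?mul1r// gt_eqF.
  by rewrite !flat_exp0// mulr0 addr0.
Unshelve. all: by end_near.
Qed.

Lemma flat_exp_smooth n : smooth_on setT (flat_exp n).
Proof.
apply: (@smooth_family nat flat_exp (fun n => n.+2) S (fun n => - n%:R) setT
  openT) => j t _; exact: flat_exp_derive.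
Qed.
End SmoothFamilies.

(** * Taylor quotients and Hadamard's lemma in one variable *)

Section Taylor.
Context (R : realType) (a : R) (U : set R^o) (oU : open U) (Ua : U a).
Implicit Types (f : R -> R).

Definition taylor_coef n f : R := derive1n n f a / n`!%:R.

(** [n] is the number of terms subtracted, so that [taylor_rem n f] has order
    [(x - a) ^ n]. *)
Fixpoint taylor_rem n f : R -> R :=
  if n is k.+1
  then taylor_rem k f - cst (taylor_coef k f) * (fun x => x - a) ^+ k else f.

Definition taylor_quot n f (x : R) : R :=
  if x == a then taylor_coef n f else taylor_rem n f x / (x - a) ^+ n.

Local Notation smooth f := (smooth_on U (f : R^o -> R^o)).

Lemma smooth_is_derive f x :
  smooth f -> U x -> is_derive x (1 : R) f (derive1 f x).
Proof.
move=> sf Ux; rewrite derive1E; apply/derivableP/derivable1_diffP.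
by have [+ _] := sf 1%N; exact.
Qed.
Lemma smooth_derive1 f : smooth f -> smooth (derive1 f).
Proof.
move=> sf; have -> : derive1 f = 'D_1 (f : R^o -> R^o).
  by apply/funext => x; rewrite derive1E.
exact: smooth_derive.
Qed.

Lemma taylor_coefS n f :
  taylor_coef n.+1 f * n.+1%:R = taylor_coef n (derive1 f).
Proof.
rewrite /taylor_coef -derive1Sn factS natrM invfM mulrA mulrAC.
by rewrite -[X in X * _ = _]mulrA mulVf ?mulr1// pnatr_eq0.
Qed.

Lemma taylor_remS n f x :
  taylor_rem n.+1 f x = taylor_rem n f x - taylor_coef n f * (x - a) ^+ n.
Proof. by rewrite /= /GRing.add/= /GRing.opp/= exprfctE. Qed.

Lemma taylor_rem_a n f : taylor_rem n.+1 f a = 0.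
Proof.
elim: n => [|n IH]; rewrite taylor_remS.
  by rewrite /= /taylor_coef derive1n0 divr1 mulr1 subrr.
by rewrite IH subrr exprS mul0r mulr0 subrr.
Qed.

Lemma taylor_rem_derive n f x : smooth f -> U x ->
  is_derive x (1 : R) (taylor_rem n.+1 f) (taylor_rem n (derive1 f) x).
Proof.
move=> sf Ux; elim: n => [|n IH].
  rewrite /= expr0 mulr1 -[X in is_derive _ _ _ X]subr0; apply: is_deriveB.
  exact: smooth_is_derive.
have dX : is_derive x (1 : R) (fun y : R => y - a) 1.
  by apply: is_derive_eq; rewrite subr0.
have dXn := @is_deriveX _ _ _ n.+1 _ _ _ dX.
have dc := is_derive_cst (taylor_coef n.+1 f) x (1 : R).
apply: is_derive_eq (is_deriveB IH (is_deriveM dc dXn)) _.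
rewrite taylor_remS -taylor_coefS scaler0 addr0; congr (_ - _).
change (taylor_coef n.+1 f * ((n.+1%:R * (x - a) ^+ n) * 1) =
  taylor_coef n.+1 f * n.+1%:R * (x - a) ^+ n); ring.
Qed.

(** Taylor's theorem with Peano's remainder: by induction on [n], since the
    derivative of a remainder is the previous remainder of [derive1 f]. *)
Lemma taylor_rem_littleo n f e : 0 < e -> smooth f ->
  \forall x \near a, `|taylor_rem n.+1 f x| <= e * `|x - a| ^+ n.
Proof.
move=> e0; elim: n f => [|n IH] f sf.
  have : {for a, continuous (f : R^o -> R^o)} by have := sf 0%N; exact.
  move/cvgrPdist_le => /(_ e e0); apply: filterS => x.
  rewrite expr0 mulr1 taylor_remS /= /taylor_coef derive1n0 divr1 mulr1.
  by rewrite distrC.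
have {}IH := IH _ (smooth_derive1 sf).
have nU : \forall x \near a, U x by exact: open_nbhs_nbhs.
have /nbhs_ballP[d /= d0 dP] : \forall x \near a,
    U x /\ `|taylor_rem n.+1 (derive1 f) x| <= e * `|x - a| ^+ n.
  by near=> x; split; near: x.
apply/nbhs_ballP; exists d => //= x; rewrite /ball/= => xd.
have dT y : `|a - y| <= `|a - x| ->
    is_derive y (1 : R) (taylor_rem n.+2 f) (taylor_rem n.+1 (derive1 f) y).
  move=> yx; apply: taylor_rem_derive => //.
  by have [] := dP y (le_lt_trans yx xd).
have cT y : `|a - y| <= `|a - x| -> {for y, continuous (taylor_rem n.+2 f)}.
  move=> yx; apply/differentiable_continuous/derivable1_diffP.
  by have [] := dT y yx.
have bnd y : `|a - y| <= `|a - x| ->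
    `|taylor_rem n.+1 (derive1 f) y| <= e * `|x - a| ^+ n.
  move=> yx; have [_ /le_trans] := dP y (le_lt_trans yx xd); apply.
  by rewrite ler_wpM2l ?(ltW e0)// lerXn2r ?nnegrE// distrC (distrC x).
have concl c : `|a - c| <= `|a - x| ->
    taylor_rem n.+2 f x - taylor_rem n.+2 f a
      = taylor_rem n.+1 (derive1 f) c * (x - a) ->
    `|taylor_rem n.+2 f x| <= e * `|x - a| ^+ n.+1.
  move=> cx; rewrite taylor_rem_a subr0 => ->.
  by rewrite normrM exprSr mulrA ler_wpM2r// bnd.
have [ax|/ltW xa] := leP a x.
  have itvP y : y \in `[a, x] -> `|a - y| <= `|a - x|.
    rewrite in_itv/= => /andP[ay yx]; rewrite distrC (distrC a).
    by rewrite !ger0_norm ?subr_ge0// lerD2r.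
  have [y /subset_itv_oo_cc/itvP/dT//| |c /itvP cx] :=
    @MVT_segment R (taylor_rem n.+2 f) (taylor_rem n.+1 (derive1 f)) _ _ ax.
    apply: continuous_in_subspaceT => y; rewrite inE/= => /itvP; exact: cT.
  exact: concl.
have itvP y : y \in `[x, a] -> `|a - y| <= `|a - x|.
  rewrite in_itv/= => /andP[xy ya].
  by rewrite !ger0_norm ?subr_ge0// lerD2l lerN2.
have [y /subset_itv_oo_cc/itvP/dT//| |c /itvP cx E] :=
  @MVT_segment R (taylor_rem n.+2 f) (taylor_rem n.+1 (derive1 f)) _ _ xa.
  apply: continuous_in_subspaceT => y; rewrite inE/= => /itvP; exact: cT.
apply: (concl c) => //.
by rewrite -[LHS]opprB E -mulrN opprB.
Unshelve. all: by end_near.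
Qed.

Lemma taylor_quot_a n f : taylor_quot n f a = taylor_coef n f.
Proof. by rewrite /taylor_quot eqxx. Qed.

Lemma taylor_remE n f x : taylor_rem n f x = taylor_quot n f x * (x - a) ^+ n.
Proof.
rewrite /taylor_quot; case: eqP => [->|/eqP xa].
  case: n => [|n]; last by rewrite taylor_rem_a subrr exprS mul0r mulr0.
  by rewrite expr0 mulr1 /taylor_coef derive1n0 divr1.
by rewrite mulfVK// expf_neq0// subr_eq0.
Qed.

Lemma taylor_quotS n f x :
  taylor_quot n f x = taylor_quot n f a + (x - a) * taylor_quot n.+1 f x.
Proof.
rewrite taylor_quot_a.
have [->|xa] := eqVneq x a; first by rewrite subrr mul0r addr0 taylor_quot_a.
have xan0 : x - a != 0 by rewrite subr_eq0.
have := taylor_remE n.+1 f x; rewrite taylor_remS taylor_remE => /eqP.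
rewrite subr_eq -subr_eq0 => /eqP E.
apply/eqP; rewrite -subr_eq0; apply/eqP/(mulIf (expf_neq0 n xan0)).
by rewrite mul0r -[RHS]E exprS; ring.
Qed.

Lemma taylor_quot_continuous n f : smooth f ->
  {for a, continuous (taylor_quot n f : R^o -> R^o)}.
Proof.
move=> sf; apply/cvgrPdist_le => e e0.
have := taylor_rem_littleo n e0 sf; apply: filterS => x.
rewrite taylor_remS taylor_remE [taylor_quot n f a]/taylor_quot eqxx.
have [->|xa] := eqVneq x a.
  by move=> _; rewrite taylor_quot_a subrr normr0 ltW.
rewrite -mulrBl normrM normrX distrC.
by rewrite ler_pM2r ?exprn_gt0 ?normr_gt0 ?subr_eq0.
Qed.

(** The quotients of [f] and of its derivatives form a family as in
    [smooth_family]. Away from [a] this is the quotient rule; at [a] both sides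
    are [taylor_coef n.+1 f], as [taylor_quotS] presents
    [taylor_quot n.+1 f] as the slope of [taylor_quot n f]. *)
Lemma taylor_quot_derive n f x : smooth f -> U x ->
  is_derive x (1 : R) (taylor_quot n f)
    (taylor_quot n (derive1 f) x + - n%:R * taylor_quot n.+1 f x).
Proof.
move=> sf Ux; have [->|xa] := eqVneq x a.
  apply: is_derive_eq.
    apply: (is_derive_slope (G := taylor_quot n.+1 f)).
      exact: taylor_quotS.
    exact: taylor_quot_continuous.
  rewrite !taylor_quot_a -taylor_coefS -addn1 natrD; ring.
have xa0 : x - a != 0 by rewrite subr_eq0.
case: n => [|n].
  rewrite oppr0 mul0r addr0 /taylor_quot (negbTE xa) /= divr1.
  apply: (near_eq_is_derive (f := f)); last exact: smooth_is_derive.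
  near=> y; case: eqP => [->|_]; last by rewrite divr1.
  by rewrite /taylor_coef derive1n0 divr1.
have dX : is_derive x (1 : R) (fun y : R => y - a) 1.
  by apply: is_derive_eq; rewrite subr0.
have dXn := @is_deriveX _ _ _ n.+1 _ _ _ dX.
have xan0 : ((fun y : R => y - a) ^+ n.+1) x != 0 by rewrite exprfctE expf_neq0.
have dV := is_deriveV xan0 dXn.
apply: (near_eq_is_derive (f := taylor_rem n.+1 f *
   (fun y => (((fun y : R => y - a) ^+ n.+1) y)^-1))).
  have : \forall y \near x, y != a.
    by apply: open_nbhs_nbhs; split; [exact: open_neq|exact: xa].
  apply: filterS => y ya; rewrite /taylor_quot (negbTE ya).
  by rewrite mulrfctE exprfctE.
apply: is_derive_eq (is_deriveM (taylor_rem_derive n sf Ux) dV) _.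
rewrite {dV xan0} !exprfctE taylor_remE taylor_remE.
rewrite (taylor_quotS n (derive1 f)) (taylor_quotS n.+1 f).
rewrite !taylor_quot_a -taylor_coefS.
move: (taylor_coef _ _) (taylor_quot n.+1 _ _) (taylor_quot n.+2 _ _) => C A B.
change ((C + (x - a) * B) * (x - a) ^+ n.+1 *
    (- (((x - a) ^+ n.+1) ^- 2) * (n.+1%:R * (x - a) ^+ n * 1))
  + ((x - a) ^+ n.+1)^-1 * ((C * n.+1%:R + (x - a) * A) * (x - a) ^+ n)
  = A + - n.+1%:R * B).
by rewrite exprS; field; rewrite expf_neq0.
Unshelve. all: by end_near.
Qed.

Lemma taylor_quot_smooth n f : smooth f -> smooth (taylor_quot n f).
Proof.
move=> sf.
pose F (t : nat * nat) := taylor_quot t.2 (derive1n t.1 f) : R^o -> R^o.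
apply: (@smooth_family _ _ F (fun t => (t.1.+1, t.2)) (fun t => (t.1, t.2.+1))
  (fun t => - t.2%:R) U oU _ (0, n)) => t x Ux.
apply: (taylor_quot_derive t.2 (f := derive1n t.1 f)) => //.
elim: (t.1) => [|j IH] //; exact: smooth_derive1.
Qed.
End Taylor.

Section Hadamard.
Context (R : realType).
(** The isomorphism of the line with the row vectors of length 1. *)
Let const1 (t : R^o) : 'rV[R]_1 := t *: (const_mx 1 : 'rV[R]_1).

Lemma smooth_const1 (U : set R^o) : smooth_on U const1.
Proof.
apply: smooth_of_cst_derive => [x|v]; first exact: ex_diff.
exists (v *: (const_mx 1 : 'rV[R]_1)); apply/funext => x.
rewrite deriveE; last exact: ex_diff.
by rewrite diff_val.
Qed.

Lemma rV1E (y : 'rV[R]_1) : y = const1 (y ord0 ord0).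
Proof. by apply/rowP => i; rewrite !mxE mulr1 !ord1. Qed.

Lemma hadamard1 (U : set 'rV[R]_1) (f : 'rV[R]_1 -> R^o) y0 : open U -> U y0 ->
  smooth_on U f -> exists G : 'rV[R]_1 -> R^o, [/\ smooth_on U G,
    (forall y, f y = f y0 + (y ord0 ord0 - y0 ord0 ord0) * G y)
    & G y0 = 'D_(const_mx 1) f y0].
Proof.
move=> oU Uy0 sf; set a := y0 ord0 ord0.
pose I := const1 @^-1` U.
have cc : continuous const1.
  by move=> x; exact: (@smooth_const1 setT 0%N x Logic.I).
have oI : open I by apply: open_comp => // x _; exact: cc.
have Ia : I a by rewrite /I/= -rV1E.
have sfI : smooth_on I (f \o const1).
  move=> k; apply: (Ck_on_comp (W := U)) => //; exact: smooth_const1.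
exists (fun y => taylor_quot a 1 (f \o const1) (y ord0 ord0)); split.
- move=> k.
  apply: (Ck_on_comp1 (W := I) (s := fun y : 'rV[R]_1 => y ord0 ord0)) => //.
  + by move=> y Uy; rewrite /I/= -rV1E.
  + exact: taylor_quot_smooth.
  + exact: smooth_coord.
- move=> y; have := taylor_quotS a 0 (f \o const1) (y ord0 ord0).
  have q0 t : taylor_quot a 0 (f \o const1) t = f (const1 t).
    by rewrite -[LHS]mulr1 -(expr0 (t - a)) -taylor_remE.
  by rewrite !q0 -!rV1E.
rewrite taylor_quot_a /taylor_coef /= divr1 derive1E.
have dc : differentiable const1 a by exact: ex_diff.
have df : differentiable f (const1 a).
  by have [+ _] := sf 1%N; apply; rewrite -rV1E.
rewrite (deriveE (1 : R^o) (differentiable_comp dc df)) diff_comp//=.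
rewrite -deriveE// [y0 in RHS]rV1E; congr ('D_ _ f _).
by rewrite diff_val /const1 scale1r.
Qed.
End Hadamard.

(** * Extending functions and fields from a chart by zero *)

Section Charts.
Context (R : realType) (m : nat) (M : manifold R m).
Local Notation cod c := (chart_map c @` chart_dom c).

Lemma chart_image_open (c : chart R m M) (O : set M) : open O ->
  open (chart_map c @` (chart_dom c `&` O)).
Proof.
move=> oO; rewrite openE => _ [q [dq Oq] <-]; rewrite /interior.
have cq : cod c (chart_map c q) by exists q.
have n1 : nbhs (chart_map c q) (cod c).
  exact: open_nbhs_nbhs (conj (@chart_cod_open _ _ _ c) cq).
have n2 : nbhs (chart_inv c (chart_map c q)) (chart_dom c `&` O).
  rewrite chart_mapK//; apply: open_nbhs_nbhs; split => //.
  by apply: openI => //; exact: chart_dom_open.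
have := chart_inv_cont cq n2; move/(filterI n1); apply: filterS.
by move=> _ [[q' dq' <-]]; rewrite /= chart_mapK// => ?; exists q'.
Qed.

Context (c : chart R m M) (Ac : atlas c).
Context (u : 'rV[R]_m -> R^o) (K : set 'rV[R]_m).
Hypotheses (su : smooth_on (cod c) u) (cK : compact K) (Kcod : K `<=` cod c).
Hypothesis (uK : forall y, u y != 0 -> K y).

(** The factor [u] is a bump function, so that the product extends by zero. *)
Definition chart_ext (w : 'rV[R]_m -> R^o) (q : M) : R :=
  if `[< chart_dom c q >] then u (chart_map c q) * w (chart_map c q) else 0.

(** Outside the chart the extension vanishes near every point, because the
    compact support of [u] is closed in the Hausdorff space [M]. *)
Lemma chart_ext_smooth w :
  smooth_on (cod c) w -> `[< smooth_fun (chart_ext w) >].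
Proof.
move=> sw; apply/asboolP => c' Ac' k; apply: Ck_on_local => _ [q dq' <-].
have [dq|dq] := pselect (chart_dom c q).
  pose U := chart_map c' @` (chart_dom c' `&` chart_dom c).
  have oU : open U by apply: chart_image_open; exact: chart_dom_open.
  exists U; first by exists q.
  have : Ck_on k U ((u * w : _ -> R^o) \o (chart_map c \o chart_inv c')).
    apply: (Ck_on_comp (W := cod c)) => //.
    - by move=> _ [q' [dq1 dq2] <-]; exists q' => //=; rewrite chart_mapK.
    - by apply: Ck_onM; [exact: chart_cod_open|exact: su|exact: sw].
    - exact: atlas_compat.
  apply: Ck_on_ext => // _ [q' [dq1 dq2] <-].
  by rewrite /= /chart_ext chart_mapK// asboolT.
pose C := chart_inv c @` K.
have clC : closed C.
  apply: compact_closed; first exact: manifold_hausdorff.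
  apply: continuous_compact => //.
  apply: continuous_in_subspaceT => y; rewrite inE => /Kcod.
  exact: chart_inv_cont.
pose U := chart_map c' @` (chart_dom c' `&` ~` C).
have oU : open U by apply: chart_image_open; exact: closed_openC.
exists U.
  exists q => //; split=> // -[y /Kcod[q' dq1 <-]]; rewrite chart_mapK// => e.
  by rewrite -e in dq.
apply: Ck_on_ext (Ck_on_cst k 0 oU) => // _ [q' [dq1 nC] <-].
rewrite /= /chart_ext chart_mapK//; case: asboolP => // dq2.
have [->|u0] := eqVneq (u (chart_map c q')) 0; first by rewrite mul0r.
by case: nC; exists (chart_map c q'); [exact: uK|rewrite chart_mapK].
Qed.
End Charts.

Section Bump.
Context (R : realType) (m : nat).

Lemma bump_exists (U : set 'rV[R]_m) a : open U -> U a ->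
  exists (u : 'rV[R]_m -> R^o) (K : set 'rV[R]_m),
  [/\ smooth_on U u, compact K, K `<=` U, (forall y, u y != 0 -> K y)
    & u a != 0].
Proof.
move=> oU Ua.
have /nbhs_ballP[e /= e0 eU] : nbhs a U by exact: open_nbhs_nbhs.
pose r := e / 2; have r0 : 0 < r by rewrite divr_gt0.
pose s (y : 'rV[R]_m) : R^o := r ^+ 2 - \sum_(i < m) (y ord0 i - a ord0 i) ^+ 2.
pose I i := `[a ord0 i - r, a ord0 i + r]%classic : set R.
pose K := [set y : 'rV[R]_m | forall i, I i (y ord0 i)].
exists (flat_exp 0 \o s), K; split.
- move=> k; apply: (Ck_on_comp1 (W := setT)) => //.
    exact: flat_exp_smooth.
  have -> : s = cst (r ^+ 2) - \sum_(i < m)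
      ((fun y : 'rV[R]_m => y ord0 i : R^o) - cst (a ord0 i))
      * ((fun y : 'rV[R]_m => y ord0 i : R^o) - cst (a ord0 i)).
    by apply/funext => y; rewrite /s /GRing.add/= /GRing.opp/= fct_sumE.
  apply: Ck_onB => //; first exact: Ck_on_cst.
  apply: Ck_on_sum => // i.
  by apply: Ck_onM => //; apply: Ck_onB => //;
    [exact: smooth_coord|exact: Ck_on_cst|exact: smooth_coord|exact: Ck_on_cst].
- apply: (@rV_compact _ _ I) => i.
  exact: segment_compact.
- move=> y Ky; apply: eU; split=> // i j; rewrite ord1.
  have := Ky j; rewrite /I/= in_itv/= => /andP[h1 h2].
  rewrite /ball/= ltr_norml /r in h1 h2 *.
  by apply/andP; split; lra.
- move=> y; rewrite /=; have [s0 _|s0] := ltP 0 (s y); last first.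
    by rewrite flat_exp0 ?eqxx.
  move=> i; rewrite /I/= in_itv/=.
  have : (y ord0 i - a ord0 i) ^+ 2 < r ^+ 2.
    rewrite -subr_gt0; apply: (lt_le_trans s0); rewrite /s lerD2l lerN2.
    by rewrite (bigD1 i)//= lerDl sumr_ge0// => j _; exact: sqr_ge0.
  rewrite -(real_normK (num_real _)) ltr_pXn2r ?nnegrE ?(ltW r0)//.
  by rewrite ltr_norml => /andP[h1 h2]; apply/andP; split; lra.
rewrite /= gt_eqF// flat_exp_gt0 /s big1 ?subr0 ?exprn_gt0// => i _.
by rewrite subrr expr0n.
Qed.
End Bump.

Section LocalFrame.
Context (R : realType) (m : nat) (M : manifold R m).
Local Notation cod c := (chart_map c @` chart_dom c).
Context (c : chart R m M) (Ac : atlas c).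
Context (u : 'rV[R]_m -> R^o) (K : set 'rV[R]_m).
Hypotheses (su : smooth_on (cod c) u) (cK : compact K) (Kcod : K `<=` cod c).
Hypothesis (uK : forall y, u y != 0 -> K y).

Definition chart_cinf (w : 'rV[R]_m -> R^o) (sw : smooth_on (cod c) w) :
  cinf M := Cinf (chart_ext_smooth Ac su cK Kcod uK sw).

Lemma cinf_smooth (f : cinf M) :
  smooth_on (cod c) (f \o chart_inv c : _ -> R^o).
Proof. by have /asboolP := valP f; exact. Qed.

Definition chart_deriv (v : 'rV[R]_m) (f : cinf M) : cinf M :=
  chart_cinf (smooth_derive v (cinf_smooth f)).

Lemma chart_derivE v f q : chart_dom c q -> chart_deriv v f q =
  u (chart_map c q) * 'D_v (f \o chart_inv c : _ -> R^o) (chart_map c q).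
Proof. by move=> dq; rewrite /= /chart_ext asboolT. Qed.

Lemma chart_cinfE w (sw : smooth_on (cod c) w) q : chart_dom c q ->
  chart_cinf sw q = u (chart_map c q) * w (chart_map c q).
Proof. by move=> dq; rewrite /= /chart_ext asboolT. Qed.

Lemma chart_cinf_out w (sw : smooth_on (cod c) w) q : ~ chart_dom c q ->
  chart_cinf sw q = 0.
Proof. by move=> dq; rewrite /= /chart_ext asboolF. Qed.

Lemma cinf_derivable v (f : cinf M) q : chart_dom c q ->
  derivable (f \o chart_inv c : _ -> R^o) (chart_map c q) v.
Proof.
move=> dq; apply: diff_derivable; have [+ _] := cinf_smooth f 1%N; apply.
by exists q.
Qed.

Lemma chart_deriv_derivation v : `[< derivation (chart_deriv v) >].
Proof.
apply/asboolP.
have out f q : ~ chart_dom c q -> chart_deriv v f q = 0.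
  exact: chart_cinf_out.
split=> [f1 f2|a f|f1 f2]; apply: cinf_ext => q.
- have [dq|dq] := pselect (chart_dom c q); last by rewrite cinfDE !out// addr0.
  rewrite cinfDE !chart_derivE// -mulrDr -deriveD//; exact: cinf_derivable.
- have [dq|dq] := pselect (chart_dom c q); last by rewrite cinfME !out// mulr0.
  rewrite cinfME cinf_cstE !chart_derivE// mulrCA; congr (_ * _).
  by rewrite -[RHS]deriveZ//; exact: cinf_derivable.
have [dq|dq] := pselect (chart_dom c q); last first.
  by rewrite cinfDE !cinfME !out// mulr0 mul0r addr0.
rewrite cinfDE !cinfME !chart_derivE//.
rewrite (_ : 'D_v _ _ =
  f1 q * 'D_v (f2 \o chart_inv c : _ -> R^o) (chart_map c q)
  + f2 q * 'D_v (f1 \o chart_inv c : _ -> R^o) (chart_map c q)).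
  by ring.
rewrite -[f1 q](congr1 f1 (chart_mapK dq)) -[f2 q](congr1 f2 (chart_mapK dq)).
by rewrite -[RHS]deriveM//; exact: cinf_derivable.
Qed.

(** The bump function occurs twice, once in the field and once in the function;
    its derivative is multiplied by [w = 0]. *)
Lemma chart_deriv_cinf v w (sw : smooth_on (cod c) w) q : chart_dom c q ->
  w (chart_map c q) = 0 -> chart_deriv v (chart_cinf sw) q =
  u (chart_map c q) ^+ 2 * 'D_v w (chart_map c q).
Proof.
move=> dq w0; rewrite chart_derivE// expr2 -mulrA; congr (_ * _).
have cq : cod c (chart_map c q) by exists q.
rewrite -(@near_eq_derive _ _ _ (u * w)); last first.
  near=> y.
  have [q' dq' <-] : cod c y.
    by near: y; apply: open_nbhs_nbhs; split=> //; exact: chart_cod_open.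
  by rewrite /= /chart_ext chart_mapK// asboolT.
rewrite deriveM; first by rewrite w0 scale0r addr0.
- by apply: diff_derivable; have [+ _] := su 1%N; exact.
- by apply: diff_derivable; have [+ _] := sw 1%N; exact.
Unshelve. all: by end_near.
Qed.

(** A coordinate vector field multiplied by the bump function. *)
Definition chart_field v : vfield M := VField (chart_deriv_derivation v).

End LocalFrame.

(** The functions witness that the values at [p] of the [m] fields are linearly
    independent; they are bump functions times coordinates centred at [p]. *)
Lemma local_frame (R : realType) (m : nat) (M : manifold R m) (p : M) :
  exists (E : 'I_m -> vfield M) (f : 'I_m -> cinf M),
    forall i j, (E i (f j) p != 0) = (i == j).
Proof.
have [c Ac dp] := atlas_cover p.
have cp : (chart_map c @` chart_dom c) (chart_map c p) by exists p.
have ocod := @chart_cod_open _ _ _ c.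
have [u [K [su cK Kc uK up]]] := bump_exists ocod cp.
have sw j : smooth_on (chart_map c @` chart_dom c)
    ((fun y : 'rV[R]_m => y ord0 j : R^o) - cst (chart_map c p ord0 j)).
  by move=> k; apply: Ck_onB => //; [exact: smooth_coord|exact: Ck_on_cst].
exists (fun i => chart_field Ac su cK Kc uK (delta_mx 0 i)).
exists (fun j => chart_cinf Ac su cK Kc uK (sw j)) => i j.
rewrite [X in X != 0]chart_deriv_cinf//; last exact: subrr.
rewrite mulf_eq0 expf_eq0 (negbTE up)/=.
have dj : derivable (fun y : 'rV[R]_m => y ord0 j : R^o) (chart_map c p)
    (delta_mx 0 i).
  exact/diff_derivable/differentiable_coord.
rewrite (deriveB dj (derivable_cst _ _ _)) derive_cst subr0.
have := derive_mx (@derivable_id _ _ (chart_map c p) (delta_mx 0 i)).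
rewrite derive_id => /rowP/(_ j); rewrite !mxE/= => <-.
by rewrite pnatr_eq0 eqb0 negbK eq_sym.
Qed.

(** On a 1-dimensional manifold all vector fields are proportional to one
    coordinate field, so that two orthogonal ones cannot both be nonzero. This
    rests on Hadamard's lemma, as a vector field is only known to be a
    derivation. With [B] the bump function and [x] the extension of the
    coordinate, the proportionality becomes a global identity between vector
    fields after multiplication by [B ^+ 3]; the factor [comp Z] is
    [B ^+ 2 * Z (x / B)] written without division. *)
Lemma dim1_orthogonal (R : realType) (m : nat) (M : manifold R m)
    (g : riemannian_metric M) (X Y : vfield M) :
  m = 1%N -> g Y Y = 1 -> g X Y = 0 -> X = 0.
Proof.
move=> m1; subst m => gYY gXY; apply: (riem_eq0 (g := g)); apply: cinf_ext => p.
have [c Ac dp] := atlas_cover p.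
set cod := chart_map c @` chart_dom c.
have cp : cod (chart_map c p) by exists p.
have ocod : open cod by exact: chart_cod_open.
have [u [K [su cK Kc uK up]]] := bump_exists ocod cp.
pose ext := @chart_cinf _ _ _ _ Ac _ _ su cK Kc uK.
pose E := chart_field Ac su cK Kc uK (const_mx 1).
have s1 : smooth_on cod (cst 1 : _ -> R^o) by move=> k; exact: Ck_on_cst.
pose B := ext _ s1; pose x := ext _ (smooth_coord ord0 ocod).
pose comp (Z : vfield M) : cinf M := B * Z x - x * Z B.
have BE q : chart_dom c q -> B q = u (chart_map c q).
  by move=> dq; rewrite [LHS]chart_cinfE// mulr1.
have compE Z : B ^+ 3 *: Z = comp Z *: E.
  apply: vfield_ext => f; apply: cinf_ext => q.
  rewrite !vfieldZE cinfME [RHS]cinfME.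
  have [dq|dq] := pselect (chart_dom c q); last first.
    have B0 : B q = 0 by exact: chart_cinf_out.
    have x0 : x q = 0 by exact: chart_cinf_out.
    have -> : (B ^+ 3) q = B q * (B q * B q) by [].
    by rewrite B0 /comp cinfBE !cinfME B0 x0 !mul0r subr0 mul0r.
  have cq : cod (chart_map c q) by exists q.
  have [G [sG fG G0]] := hadamard1 ocod cq (cinf_smooth Ac f).
  (* Hadamard's lemma at q, multiplied by B * B to become global *)
  have id1 : (f - cinf_cst M (f q)) * (B * B)
      = (x - cinf_cst M (chart_map c q ord0 ord0) * B) * ext _ sG.
    apply: cinf_ext => r; rewrite !(cinfME, cinfBE, cinf_cstE).
    have [dr|dr] := pselect (chart_dom c r); last first.
      have -> : B r = 0 by exact: chart_cinf_out.
      have -> : x r = 0 by exact: chart_cinf_out.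
      by rewrite !(mul0r, mulr0) subr0 mul0r.
    rewrite !chart_cinfE//.
    have := fG (chart_map c r); rewrite /= !chart_mapK// => ->.
    rewrite /cst; ring.
  have := congr1 (fun h : cinf M => (Z h : cinf M) q) id1.
  rewrite !vfieldM_at; first last.
  - exact: subrr.
  - by rewrite cinfBE cinfME cinf_cstE !chart_cinfE// mulr1 mulrC subrr.
  rewrite !vfieldB vfield_cst subr0 vfieldZ.
  rewrite !(cinfME, cinfBE, cinf_cstE) [ext G sG q]chart_cinfE// G0 -BE// => e.
  change (B q * (B q * B q) * (Z f : cinf M) q
    = (B q * (Z x : cinf M) q - x q * (Z B : cinf M) q) * (E f : cinf M) q).
  have -> : x q = chart_map c q ord0 ord0 * B q.
    by rewrite BE// mulrC; exact: chart_cinfE.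
  rewrite [E f q]chart_derivE// -BE//.
  transitivity (B q * ((Z f : cinf M) q * (B q * B q))); first by ring.
  by rewrite e; ring.
have gB Z W : B ^+ 3 * B ^+ 3 * g Z W = comp Z * comp W * g E E.
  by rewrite -mulrA -riemZr -riemZl !compE riemZl riemZr mulrA.
have Bp : (B ^+ 3) p != 0.
  by have -> : (B ^+ 3) p = B p * (B p * B p) by []; rewrite !mulf_neq0 ?BE.
have gBp Z W :
    (B ^+ 3) p * (B ^+ 3) p * g Z W p = comp Z p * comp W p * g E E p.
  by have := congr1 (fun h : cinf M => h p) (gB Z W).
have XYp := gBp X Y; have YYp := gBp Y Y; have XXp := gBp X X.
rewrite gYY cinf1E mulr1 in YYp; rewrite gXY cinf0E mulr0 in XYp.
have : comp Y p * comp Y p * g E E p != 0 by rewrite -YYp mulf_neq0.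
rewrite !mulf_eq0 !negb_or => /andP[/andP[Y0 _] E0].
have X0 : comp X p = 0.
  move/esym/eqP: XYp.
  by rewrite !mulf_eq0 (negbTE Y0) (negbTE E0) !orbF => /eqP.
by apply: (mulfI (mulf_neq0 Bp Bp)); rewrite XXp X0 !mul0r mulr0.
Qed.

(** Otherwise every vector field would be proportional to [xi] at [p], which
    contradicts the independence of two of the fields of [local_frame]. *)
Lemma exists_phi_neq0 (R : realType) (n : nat) (M : manifold R (2 * n).+1%N)
    (S : almost_contact_metric M) (p : M) : (0 < n)%N ->
  exists X, gm S (phi S X) (phi S X) p != 0.
Proof.
move=> n0; apply: contrapT => /forallNP phi0.
have span (X : vfield M) (f : cinf M) :
    (X f : cinf M) p = (eta S X : cinf M) p * (xi S f : cinf M) p.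
  have : (phi S (phi S X) f : cinf M) p = 0.
    apply: (riem_eq0_at (g := gm S)); rewrite gm_phi eta_phi mul0r subr0.
    by have /negP/negPn/eqP := phi0 X.
  rewrite phi_sqr vfieldDE vfieldNE vfieldZE cinfDE cinfNE cinfME.
  by move/eqP; rewrite addrC subr_eq0 => /eqP.
have [E [f Ef]] := local_frame p.
have i1 : (1 < (2 * n).+1)%N by rewrite ltnS muln_gt0.
pose i := Ordinal i1.
have e0 : (eta S (E ord0) : cinf M) p != 0.
  have : (E ord0 (f ord0) : cinf M) p != 0 by rewrite Ef eqxx.
  by rewrite span; apply: contraNneq => ->; rewrite mul0r.
have fi : (xi S (f i) : cinf M) p != 0.
  have : (E i (f i) : cinf M) p != 0 by rewrite Ef eqxx.
  by rewrite span; apply: contraNneq => ->; rewrite mulr0.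
have : (E ord0 (f i) : cinf M) p != 0 by rewrite span mulf_neq0.
by rewrite Ef.
Qed.

(** * The soliton field *)

Theorem theorem3p2 (R : realType) (n : nat) (M : manifold R (2 * n).+1%N)
    (S : almost_contact_metric M) (D : connection M) (k mu : R)
    (V : vfield M) (lambda : R) (alpha : cinf M) (b : cinf M) :
  levi_civita (gm S) D ->
  almost_kenmotsu S ->
  in_nullity' S D k mu (xi S) ->
  (exists X, h'_tensor S X <> 0) ->
  quasi_yamabe_soliton (gm S) D V lambda alpha ->
  V = b *: xi S ->
  [/\ exists c : R, V = cinf_cst M c *: xi S,
      strict_infinitesimal_contact (eta S) V
    & forall X, lie_endo V (h'_tensor S) X = 0].
Proof.
move=> LC AK N h'X QY VE; rewrite VE in QY.
have n0 : (0 < n)%N.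
  have [X] := h'X; rewrite lt0n => hX; apply/eqP => n0; apply: hX.
  apply: (dim1_orthogonal (g := gm S) (Y := xi S)).
  - by rewrite n0.
  - exact: xi_unit.
  - by rewrite -eta_riem (eta_h' LC AK).
have b0 : b = 0.
  apply: cinf_ext => p; have [X phiX] := exists_phi_neq0 S p n0.
  have := congr1 (fun f : cinf M => f p) (soliton_phi LC AK N h'X QY X).
  by rewrite cinfME => /eqP; rewrite mulf_eq0 (negbTE phiX) orbF => /eqP.
have V0 : V = 0 by rewrite VE b0 scale0r.
rewrite V0; split.
- by exists 0; rewrite (_ : cinf_cst M 0 = 0) ?scale0r//; exact: cinf_ext.
- by move=> X; rewrite /lie_form lie0l linear0 vfield0E subr0 mul0r.
- by move=> X; rewrite /lie_endo !lie0l (h'0 LC AK) subr0.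
Qed.
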